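(* Let $R_1$ and $R_2$ be two finite rings with subrings $S_1$ and $S_2$ respectively. If $(\phi,\psi)$ is a $\mathbb{Z}$-isoclinism from $(S_1,R_1)$ to $(S_2,R_2)$, then $\Pr(S_1,R_1)=\Pr(S_2,R_2)$.
   Context: Rings are associative and are not required to have an identity; a subring is an additive subgroup closed under multiplication. For a ring $R$ and a subring $S$ of $R$: $[s,r]=sr-rs$ is the additive commutator; $Z(S,R)=\{s\in S: sr=rs \text{ for all } r\in R\}$; $[S,R]$ is the subgroup of $(R,+)$ generated by $\{[s,r]: s\in S, r\in R\}$. The notations $R/Z(S,R)$ and $S/Z(S,R)$ denote additive quotient groups. For finite $R$, $\Pr(S,R)=\dfrac{|\{(s,r)\in S\times R: sr=rs\}|}{|S|\,|R|}$. Definition ($\mathbb{Z}$-isoclinism of pairs). Let $S_i$ be a subring of a ring $R_i$ and write $Z_i=Z(S_i,R_i)$, $i=1,2$. A $\mathbb{Z}$-isoclinism from $(S_1,R_1)$ to $(S_2,R_2)$ is a pair $(\phi,\psi)$ where $\phi:R_1/Z_1\to R_2/Z_2$ is an isomorphism of additive groups with $\phi(S_1/Z_1)=S_2/Z_2$, and $\psi:[S_1,R_1]\to[S_2,R_2]$ is an isomorphism of additive groups, such that $\psi([u,v])=[u',v']$ whenever $u\in S_1$, $v\in R_1$, $u'\in S_2$, $v'\in R_2$ satisfy $\phi(u+Z_1)=u'+Z_2$ and $\phi(v+Z_1)=v'+Z_2$. *)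

(* Defs.v *)
From HB Require Import structures.
From mathcomp Require Import all_boot all_algebra all_fingroup.

Set Implicit Arguments.
Unset Strict Implicit.
Unset Printing Implicit Defensive.

Import GRing.Theory FinRing.Theory.
Local Open Scope ring_scope.

(* The ring structures of ssralg all have a multiplicative identity, so       *)
(* associative rings without identity get their own structure. Their product  *)
(* is written x ** y.                                                         *)
HB.mixin Record Zmodule_isRng R of GRing.Zmodule R := {
  rmul : R -> R -> R;
  rmulA : associative rmul;
  rmulDl : left_distributive rmul +%R;
  rmulDr : right_distributive rmul +%R
}.

#[short(type="rngType")]
HB.structure Definition Rng := {R of GRing.Zmodule R & Zmodule_isRng R}.

#[short(type="finRngType")]
HB.structure Definition FinRng := {R of Rng R & Finite R}.

(* As for the structures of finalg, the finGroupType structure of a finite    *)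
(* ring is that of its additive group: in group_scope, 1 is 0, x * y is x + y,*)
(* {group R} is the type of additive subgroups, and G / H, <<A>>, isom, ...   *)
(* all refer to addition.                                                     *)
#[non_forgetful_inheritance]
HB.instance Definition _ (R : finRngType) := [finGroupMixin of R for +%R].
Coercion FinRng_to_baseFinGroup (R : finRngType) := FinStarMonoid.clone R _.
Coercion FinRng_to_finGroup (R : finRngType) := FinGroup.clone R _.

Notation "x ** y" := (rmul x y) (at level 40, left associativity) : ring_scope.

Definition acomm (R : rngType) (s r : R) : R := s ** r - r ** s.

Definition subring (R : finRngType) (S : {group R}) : Prop :=
  {in S &, forall x y, x ** y \in S}.

Definition relcenter (R : finRngType) (S : {set R}) : {set R} :=
  [set s in S | [forall r, s ** r == r ** s]].

Definition relcommutator (R : finRngType) (S : {set R}) : {set R} :=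
  <<[set acomm s r | s in S, r in [set: R]]>>%g.

Definition Pr (R : finRngType) (S : {set R}) : rat :=
  #|[set p in setX S [set: R] | p.1 ** p.2 == p.2 ** p.1]|%:R
    / (#|S| * #|[set: R]|)%:R.

Lemma relcenter_group_set (R : finRngType) (S : {group R}) :
  group_set (relcenter S).
Proof.
have rmul0 (r : R) : r ** 0 = 0.
  by apply: (addrI (r ** 0)); rewrite -rmulDr !addr0.
have mul0r (r : R) : 0 ** r = 0.
  by apply: (addrI (0 ** r)); rewrite -rmulDl !addr0.
apply/group_setP; split=> [|x y].
  by rewrite inE group1; apply/forallP=> r; rewrite rmul0 mul0r.
rewrite !inE => /andP[Sx /forallP cx] /andP[Sy /forallP cy].
rewrite groupM //; apply/forallP=> r.
by rewrite [(x * y)%g]zmodMgE rmulDl rmulDr (eqP (cx r)) (eqP (cy r)).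
Qed.

Canonical relcenter_group (R : finRngType) (S : {group R}) : {group R} :=
  Group (relcenter_group_set S).

Canonical relcommutator_group (R : finRngType) (S : {set R}) : {group R} :=
  Eval hnf in [group of relcommutator S].

(* The coset u + Z(S, R) is coset (relcenter S) u. Only the values of psi on  *)
(* [S1, R1] matter.                                                           *)
Record Zisoclinism (R1 R2 : finRngType) (S1 : {group R1}) (S2 : {group R2})
    (phi : {morphism ([set: R1] / relcenter S1)%g >-> coset_of (relcenter S2)})
    (psi : {morphism relcommutator S1 >-> R2}) : Prop := {
  phi_isom : isom ([set: R1] / relcenter S1)%g ([set: R2] / relcenter S2)%g phi;
  phi_sub : (phi @* (S1 / relcenter S1) = S2 / relcenter S2)%g;
  psi_isom : isom (relcommutator S1) (relcommutator S2) psi;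
  psi_acomm : forall (u v : R1) (u' v' : R2),
    u \in S1 -> u' \in S2 ->
    phi (coset (relcenter S1) u) = coset (relcenter S2) u' ->
    phi (coset (relcenter S1) v) = coset (relcenter S2) v' ->
    psi (acomm u v) = acomm u' v'
}.

(* Main.v *)
Require Import Defs.
From mathcomp Require Import all_boot all_algebra all_fingroup.

(** Write Z_i for Z(S_i, R_i), and call u in R1 and u' in R2 related when phi
    maps u + Z_1 to u' + Z_2. Since phi is a bijection of cosets, each u has
    exactly |Z_2| related elements and each u' exactly |Z_1| (lemmas
    [card_related_right] and [card_related_left]). Double counting related pairs
    ([double_counting]) then shows that whenever A1 and A2 are sets that
    correspond under the relation, |A1| |Z_2| = |A2| |Z_1|. Two such
    correspondences are S1 with S2 ([related_mem]) and R1 with R2. A third, for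
    the componentwise relation on pairs, in which the degrees are squared, is
    that of the commuting pairs in S1 x R1 with those in S2 x R2: psi carries
    [u, v] to [u', v'] and is injective, so one commutator vanishes exactly when
    the other does ([related_commute]). Hence the numerator and the denominator
    of Pr both change by the factor (|Z_1| / |Z_2|)^2, and Pr is preserved.

    Comparing elements of R1 and R2 through a relation, instead of through
    coset representatives, makes it unnecessary to check that the commutator
    is well defined on cosets: this is built into the compatibility of psi. *)

Set Implicit Arguments.
Unset Strict Implicit.
Unset Printing Implicit Defensive.

Import GRing.Theory FinRing.Theory.
Local Open Scope ring_scope.

(** Both sides count the pairs of e that meet A1: such a pair lies over A2 as
    well. *)
Lemma double_counting (T1 T2 : finType) (e : T1 -> T2 -> bool) (d1 d2 : nat)
    (A1 : {set T1}) (A2 : {set T2}) :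
    (forall x, #|[set y | e x y]| = d2) ->
    (forall y, #|[set x | e x y]| = d1) ->
    (forall x y, e x y -> (x \in A1) = (y \in A2)) ->
  (#|A1| * d2 = #|A2| * d1)%N.
Proof.
move=> deg2 deg1 satA.
rewrite -!sum_nat_const.
transitivity (\sum_(x in A1) \sum_(y in A2) (e x y : nat))%N.
  apply: eq_bigr => x A1x; rewrite -(deg2 x) -sum1_card.
  rewrite big_mkcond [RHS]big_mkcond /=; apply: eq_bigr => y _.
  rewrite inE; case exy: (e x y); last by case: (y \in A2).
  by rewrite -(satA _ _ exy) A1x.
rewrite exchange_big /=; apply: eq_bigr => y A2y.
rewrite -(deg1 y) -sum1_card.
rewrite big_mkcond [RHS]big_mkcond /=; apply: eq_bigr => x _.
rewrite inE; case exy: (e x y); last by case: (x \in A1).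
by rewrite (satA _ _ exy) A2y.
Qed.

Lemma card_pair_rel (T1 T2 : finType) (P : pred T1) (Q : pred T2) :
  #|[set p : T1 * T2 | P p.1 && Q p.2]| = (#|[set x | P x]| * #|[set y | Q y]|)%N.
Proof. by rewrite -cardsX; apply: eq_card => p; rewrite !inE. Qed.

Definition commuting_pairs (R : finRngType) (S : {set R}) : {set R * R} :=
  [set p in setX S [set: R] | p.1 ** p.2 == p.2 ** p.1].

Section RelativeCenter.

Variables (R : finRngType) (S : {group R}).

Lemma relcenter_norm (u : R) : u \in 'N(relcenter S)%g.
Proof.
apply/normP/setP=> x; rewrite mem_conjg conjgE.
by rewrite !zmodMgE !zmodVgE opprK addrC subrK.
Qed.

Lemma coset_relcenterP (u v : R) :
  reflect (coset (relcenter S) u = coset (relcenter S) v)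
          (u \in relcenter S :* v)%g.
Proof. exact: rcoset_kercosetP (relcenter_norm u) (relcenter_norm v). Qed.

Lemma card_coset_relcenter (v : R) :
  #|[set u | coset (relcenter S) u == coset (relcenter S) v]| = #|relcenter S|.
Proof.
rewrite -(card_rcoset (relcenter S) v); apply: eq_card => u; rewrite inE.
exact: sameP eqP (coset_relcenterP u v).
Qed.

Lemma relcenter_sub : relcenter S \subset S.
Proof. by apply/subsetP=> x; rewrite inE => /andP[]. Qed.

Lemma mem_quotient_relcenter (A : {set R}) (u : R) :
  u \in A -> coset (relcenter S) u \in (A / relcenter S)%g.
Proof. by move=> Au; apply: mem_morphim (relcenter_norm u) Au. Qed.

Lemma mem_coset_relcenter (u : R) :
  (coset (relcenter S) u \in S / relcenter S)%g = (u \in S).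
Proof.
apply/idP/idP; last exact: mem_quotient_relcenter.
case/morphimP=> w _ Sw /coset_relcenterP/rcosetP[z Zz ->].
by rewrite groupM // (subsetP relcenter_sub).
Qed.

End RelativeCenter.

Section Isoclinism.

Variables (R1 R2 : finRngType) (S1 : {group R1}) (S2 : {group R2}).
Variable phi :
  {morphism ([set: R1] / relcenter S1)%g >-> coset_of (relcenter S2)}.
Variable psi : {morphism relcommutator S1 >-> R2}.
Hypothesis iso : Zisoclinism phi psi.

Definition related (u : R1) (u' : R2) : bool :=
  phi (coset (relcenter S1) u) == coset (relcenter S2) u'.

(** By surjectivity of the quotient map, phi (u + Z_1) is a coset w + Z_2, and
    the elements related to u are exactly those of this coset. *)
Lemma card_related_right u : #|[set u' | related u u']| = #|relcenter S2|.
Proof.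
have /isomP[_ im_phi] := phi_isom iso.
have: phi (coset (relcenter S1) u) \in ([set: R2] / relcenter S2)%g.
  by rewrite -im_phi mem_morphim ?mem_quotient_relcenter ?inE.
case/morphimP=> w _ _ phi_u; rewrite -(card_coset_relcenter S2 w).
by apply: eq_card => u'; rewrite !inE /related phi_u eq_sym.
Qed.

(** Surjectivity of phi writes u' + Z_2 as phi (w + Z_1), and injectivity of phi
    confines the elements related to u' to the single coset w + Z_1. *)
Lemma card_related_left u' : #|[set u | related u u']| = #|relcenter S1|.
Proof.
have /isomP[inj_phi im_phi] := phi_isom iso.
have: coset (relcenter S2) u' \in (phi @* ([set: R1] / relcenter S1))%g.
  by rewrite im_phi mem_quotient_relcenter ?inE.
case/morphimP=> _ _ /morphimP[w _ _ ->] phi_w.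
rewrite -(card_coset_relcenter S1 w); apply: eq_card => u.
rewrite !inE /related phi_w; apply/eqP/eqP=> [|-> //].
by apply: (injmP inj_phi); rewrite mem_quotient_relcenter ?inE.
Qed.

(** Membership in S1 is a property of cosets because Z_1 lies in S1, and phi
    carries S1 / Z_1 onto S2 / Z_2. *)
Lemma related_mem u u' : related u u' -> (u \in S1) = (u' \in S2).
Proof.
have /isomP[inj_phi _] := phi_isom iso.
move/eqP=> phi_u; rewrite -(mem_coset_relcenter S2) -phi_u -(phi_sub iso).
rewrite -(mem_coset_relcenter S1).
have Ru : coset (relcenter S1) u \in ([set: R1] / relcenter S1)%g.
  by rewrite mem_quotient_relcenter ?inE.
apply/idP/idP=> [|/morphimP[w Rw Sw /(injmP inj_phi) -> //]].
exact: mem_morphim.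
Qed.

(** Two elements commute when their commutator is 0, and the injective additive
    map psi both preserves and reflects 0. *)
Lemma related_commute u v u' v' :
    u \in S1 -> related u u' -> related v v' ->
  (u ** v == v ** u) = (u' ** v' == v' ** u').
Proof.
move=> S1u uu' vv'; have S2u' : u' \in S2 by rewrite -(related_mem uu').
have /isomP[inj_psi _] := psi_isom iso.
have psi_uv := psi_acomm iso S1u S2u' (eqP uu') (eqP vv').
have uv_in : acomm u v \in relcommutator S1.
  by rewrite mem_gen // imset2_f // inE.
rewrite -(subr_eq0 (u ** v)) -(subr_eq0 (u' ** v')) -!/(acomm _ _) -psi_uv.
by rewrite -!zmod1gE; apply/esym/(morph_injm_eq1 inj_psi).
Qed.

Lemma card_commuting_pairs :
  (#|commuting_pairs S1| * #|relcenter S2| ^ 2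
   = #|commuting_pairs S2| * #|relcenter S1| ^ 2)%N.
Proof.
apply: (@double_counting _ _
  (fun p q => related p.1 q.1 && related p.2 q.2)) => [p | q | p q].
- by rewrite card_pair_rel !card_related_right.
- rewrite (card_pair_rel (related^~ q.1) (related^~ q.2)).
  by rewrite !card_related_left.
case/andP=> e1 e2; rewrite !inE !andbT -(related_mem e1).
by case S1p: (p.1 \in S1) => //=; apply: related_commute.
Qed.

Lemma card_subrings : (#|S1| * #|relcenter S2| = #|S2| * #|relcenter S1|)%N.
Proof.
exact: double_counting card_related_right card_related_left related_mem.
Qed.

Lemma card_rings :
  (#|[set: R1]| * #|relcenter S2| = #|[set: R2]| * #|relcenter S1|)%N.
Proof.
apply: double_counting card_related_right card_related_left _ => u u' _.
by rewrite !inE.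
Qed.

End Isoclinism.

Theorem theorem3p3 (R1 R2 : finRngType)
    (S1 : {group R1}) (S2 : {group R2})
    (hS1 : subring S1) (hS2 : subring S2)
    (phi : {morphism ([set: R1] / relcenter S1)%g >-> coset_of (relcenter S2)})
    (psi : {morphism relcommutator S1 >-> R2}) :
  Zisoclinism phi psi -> Pr S1 = Pr S2.
Proof.
move=> iso; rewrite /Pr -!/(commuting_pairs _).
have cardC := card_commuting_pairs iso.
have cardS := card_subrings iso; have cardR := card_rings iso.
have nz (R : finRngType) (S : {group R}) :
    (#|S| * #|[set: R]|)%:R != 0 :> rat.
  rewrite Num.Theory.pnatr_eq0 -lt0n muln_gt0 cardG_gt0 /=.
  exact: (cardG_gt0 [set: R]%G).
apply/eqP; rewrite eqr_div ?nz // -!natrM Num.Theory.eqr_nat.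
(* The cardinal equations compare products with |Z_1| and |Z_2|, so both
   sides are multiplied by (|Z_1| |Z_2|)^2 to make them applicable. *)
have Z1gt0 := cardG_gt0 (relcenter_group S1).
have Z2gt0 := cardG_gt0 (relcenter_group S2).
rewrite /= in Z1gt0 Z2gt0.
rewrite -(eqn_pmul2r (_ : 0 < #|relcenter S2| ^ 2 * #|relcenter S1| ^ 2)%N);
  last by rewrite muln_gt0 !expn_gt0 Z1gt0 Z2gt0.
have cardSR : (#|S2| * #|[set: R2]| * #|relcenter S1| ^ 2
             = #|S1| * #|[set: R1]| * #|relcenter S2| ^ 2)%N.
  by rewrite -!mulnn !(mulnACA _ _ #|relcenter _|) cardS cardR.
rewrite mulnACA cardC cardSR -mulnACA.
by rewrite (mulnC (#|relcenter S1| ^ 2)%N).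
Qed.
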